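(* Let $\lambda\in\mathbb C\setminus(\mathbb Z\setminus\{0\})$, with notation as in the context. (i) For integers $k,k'\ge0$, $|l|\le k$, $|l'|\le k'$, $\langle e_{kl},e_{k'l'}\rangle=0$ unless $k=k'$ and $l+l'=0$. (ii) For each fixed integer $l\ge0$, the polynomials $f_{kl}$, $k\ge l$, form an orthogonal basis of $\mathbb C[H]$ with respect to the bilinear form $\langle f,g\rangle_l=\mathrm{tr}\big(f(H)g(H)T_1(H)\cdots T_l(H)\big)$. (iii) For $0\le l\le k$, up to a constant factor $f_{kl}(H)$ coincides with $${}_3F_2\left(\begin{matrix}l-k,\ l+k+1,\ \tfrac12(1-\lambda-H)\\ l+1,\ l+1-\lambda\end{matrix}\ \Big|\ 1\right).$$
   Context: $\mathfrak{sl}(2)$ has basis $X,H,Y$ with $[X,Y]=H$, $[H,X]=2X$, $[H,Y]=-2Y$. $\mathfrak A_\lambda=U(\mathfrak{sl}(2))/I_\lambda$, where $I_\lambda$ is the two-sided ideal generated by $2YX+\frac12H^2+H-\frac12(\lambda^2-1)$; in $\mathfrak A_\lambda$, $XY=\frac14(\lambda^2-(H-1)^2)$. $\mathfrak{gl}(\lambda)$ is $\mathfrak A_\lambda$ with bracket $[a,b]=ab-ba$. The subalgebra generated by $H$ is identified with $\mathbb C[H]$; for $l>0$ every element of $H$-weight $2l$ (resp. $-2l$) is uniquely $X^lf(H)$ (resp. $f(H)Y^l$) with $f\in\mathbb C[H]$. The trace $\mathrm{tr}:\mathfrak{gl}(\lambda)\to\mathbb C$ is the linear functional with $\mathrm{tr}(ab)=\mathrm{tr}(ba)$,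 vanishing on elements of nonzero $H$-weight, whose restriction to $\mathbb C[H]$ is given by $\sum_{m\ge0}\mathrm{tr}(H^m)\frac{t^m}{m!}=\frac{e^{\lambda t}-e^{-\lambda t}}{e^t-e^{-t}}$ if $\lambda\neq0$ and $=\frac{2t}{e^t-e^{-t}}$ if $\lambda=0$. $\langle u,v\rangle=\mathrm{tr}(uv)$. For integers $k\ge0$, $|l|\le k$: $e_{kl}=(\mathrm{ad}\,Y)^{k-l}(X^k)$; for $0\le l\le k$, $f_{kl},f_{k,-l}\in\mathbb C[H]$ are defined by $(\mathrm{ad}\,Y)^{k-l}(X^k)=X^lf_{kl}(H)$, $(\mathrm{ad}\,Y)^{k+l}(X^k)=f_{k,-l}(H)Y^l$. $T_i(H)=\frac14(\lambda^2-(H+2i-1)^2)$, empty products equal $1$. ${}_3F_2\left(\begin{matrix}a_1,a_2,a_3\\ b_1,b_2\end{matrix}\,\big|\,z\right)=\sum_{i\ge0}\frac{(a_1)_i(a_2)_i(a_3)_i}{(b_1)_i(b_2)_i}\frac{z^i}{i!}$, $(a)_0=1$, $(a)_i=a(a+1)\cdots(a+i-1)$. *)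

(* Defs.v *)
From mathcomp Require Import all_boot all_algebra.
From mathcomp Require Import complex.
From mathcomp Require Import Rstruct.
Set Implicit Arguments. Unset Strict Implicit. Unset Printing Implicit Defensive.
Import GRing.Theory Num.Theory.
Local Open Scope ring_scope.

Definition CC : numClosedFieldType := (Rdefinitions.R)[i].

Definition shiftp (s : CC) (p : {poly CC}) : {poly CC} := p \Po ('X + s%:P).

Definition Tp (lam : CC) (i : int) : {poly CC} :=
  4^-1 *: ((lam ^+ 2)%:P - ('X + ((2 * i - 1)%:~R)%:P) ^+ 2).

(* In A_lambda:  X^b Y^b = prod_{j<b} T_{-j}(H),  Y^a X^a = T_1(H) ... T_a(H). *)
Definition XYpow (lam : CC) (b : nat) : {poly CC} := \prod_(j < b) Tp lam (- (j : nat)%:Z).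
Definition YXpow (lam : CC) (a : nat) : {poly CC} := \prod_(i < a) Tp lam (i.+1)%:Z.

(* Homogeneous elements of A_lambda.  An element of H-weight 2m is uniquely
   X^m p(H) (m >= 0) or p(H) Y^(-m) (m < 0); we encode it as the pair (m, p). *)
Record welt := WElt { wt : int; wp : {poly CC} }.

(* Product in A_lambda of homogeneous elements, derived from the relations
   p(H) X = X p(H+2),  Y p(H) = p(H+2) Y,  XY = T_0(H),  YX = T_1(H). *)
Definition wmul (lam : CC) (x y : welt) : welt :=
  let m := wt x in let n := wt y in let p := wp x in let q := wp y in
  if (0 <= m) && (0 <= n) then WElt (m + n) (shiftp (2 * n%:~R) p * q)
  else if (m < 0) && (n < 0) then WElt (m + n) (p * shiftp (2 * (- m)%:~R) q)
  else if 0 <= m then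
    (* X^m p q Y^b, b = -n *)
    let c := minn `|m|%N `|n|%N in
    WElt (m + n) (shiftp (- (2 * c%:R)) (p * q) * XYpow lam c)
  else
    (* p Y^a X^n q, a = -m *)
    let a := `|m|%N in let nn := `|n|%N in
    if (a <= nn)%N then WElt (m + n) (shiftp (2 * (nn - a)%:R) (p * YXpow lam a) * q)
    else WElt (m + n) (p * shiftp (2 * (a - nn)%:R) (YXpow lam nn * q)).

(* Difference of two homogeneous elements of the SAME weight (only used so). *)
Definition wsub (x y : welt) : welt := WElt (wt x) (wp x - wp y).

Definition wX : welt := WElt 1 1.
Definition wY : welt := WElt (-1) 1.

Definition adY (lam : CC) (x : welt) : welt := wsub (wmul lam wY x) (wmul lam x wY).

Definition e_ (lam : CC) (k : nat) (l : int) : welt :=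
  iter `|k%:Z - l|%N (adY lam) (WElt k%:Z 1).

(* f_{kl} for 0 <= l <= k:  e_{kl} = X^l f_{kl}(H). *)
Definition f_ (lam : CC) (k l : nat) : {poly CC} := wp (e_ lam k l%:Z).

(* The moments mu m = tr(H^m): the sequence with
   (sum_m mu m t^m/m!) (e^t - e^{-t}) = e^{lam t} - e^{-lam t}   (lam != 0)
   (sum_m mu m t^m/m!) (e^t - e^{-t}) = 2 t                      (lam = 0),
   as an identity of formal power series (coefficient of t^n, all n). *)
Definition trace_moments (lam : CC) (mu : nat -> CC) : Prop :=
  forall n : nat,
    \sum_(i < n.+1) (mu i / (i`!)%:R) * ((1 - (-1) ^+ (n - i)) / ((n - i)`!)%:R)
    = if lam != 0 then (lam ^+ n - (- lam) ^+ n) / (n`!)%:R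
      else (if n == 1%N then 2 else 0).

Definition trp (mu : nat -> CC) (p : {poly CC}) : CC :=
  \sum_(i < size p) p`_i * mu i.

Definition trw (mu : nat -> CC) (x : welt) : CC :=
  if wt x == 0 then trp mu (wp x) else 0.

Definition wform (lam : CC) (mu : nat -> CC) (u v : welt) : CC :=
  trw mu (wmul lam u v).

Definition lform (lam : CC) (mu : nat -> CC) (l : nat) (f g : {poly CC}) : CC :=
  trp mu (f * g * \prod_(i < l) Tp lam (i.+1)%:Z).

Definition poch (R : comPzRingType) (a : R) (i : nat) : R :=
  \prod_(j < i) (a + j%:R).

(* 3F2(l-k, l+k+1, (1-lam-H)/2 ; l+1, l+1-lam | 1) as a polynomial in H.
   The series terminates: (l-k)_i = 0 for i > k-l, so we sum over i <= k-l. *)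
Definition F32 (lam : CC) (k l : nat) : {poly CC} :=
  \sum_(i < (k - l).+1)
    ((poch ((l%:Z - k%:Z)%:~R : CC) i * poch ((l + k + 1)%:R : CC) i
      / (poch ((l + 1)%:R : CC) i * poch ((l + 1)%:R - lam) i * (i`!)%:R))
     *: poch (2^-1 *: ((1 - lam)%:P - 'X)) i).

(* Main.v *)
From HB Require Import structures.
Require Import Defs.
From mathcomp Require Import all_boot all_order all_algebra.
From mathcomp Require Import complex Rstruct ring zify.
Set Implicit Arguments. Unset Strict Implicit. Unset Printing Implicit Defensive.
Import Order.TTheory GRing.Theory Num.Theory.
Local Open Scope ring_scope.

(** Realising [A_lambda] by difference operators in [H] shows that the product is
    associative, and the generating function of the moments gives
    [tr (F(H+1) - F(H-1)) = F(lambda) - F(-lambda)] (or [2 F'(0)] when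
    [lambda = 0]), hence [tr [Y, u] = 0] and [ad Y] is skew for the trace form.
    On [X^(l+1) f(H)], [ad Y] acts as [f |-> T_(l+1) f - T_0 f(H-2)]; its adjoint
    between [<,>_(l+1)] and [<,>_l] is [g |-> g - g(H+2)], which lowers degrees.
    So [f_kl], obtained from [1] by [k-l] such steps and of degree [k-l], is
    orthogonal to all polynomials of smaller degree, which is (ii).  By skewness (i)
    reduces to the case [l = l' = 0] of (ii).  For (iii), in the basis of Pochhammer
    symbols of [x = (1-lambda-H)/2] the operator sends [(x)_i] to
    [(2l+2+i) (x)_(i+1) - (l+1+i)(l+1+i-lambda) (x)_i], and the coefficients of the
    hypergeometric polynomials satisfy the corresponding contiguity relation. *)

(** * Translations of polynomials in [H] and the factors [Tp] *)

Lemma shiftp0 (p : {poly CC}) : shiftp 0 p = p.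
Proof. by rewrite /shiftp addr0 comp_polyXr. Qed.

Lemma shiftp1 (s : CC) : shiftp s 1 = 1.
Proof. by rewrite /shiftp comp_polyC. Qed.

Lemma shiftpM (s : CC) (p q : {poly CC}) : shiftp s (p * q) = shiftp s p * shiftp s q.
Proof. by rewrite /shiftp comp_polyM. Qed.

Lemma shiftpB (s : CC) (p q : {poly CC}) : shiftp s (p - q) = shiftp s p - shiftp s q.
Proof. by rewrite /shiftp comp_polyB. Qed.

Lemma shiftpZ (s c : CC) (p : {poly CC}) : shiftp s (c *: p) = c *: shiftp s p.
Proof. by rewrite /shiftp comp_polyZ. Qed.

Lemma shiftp_sum (s : CC) I r (P : pred I) (F : I -> {poly CC}) :
  shiftp s (\sum_(i <- r | P i) F i) = \sum_(i <- r | P i) shiftp s (F i).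
Proof. by rewrite /shiftp raddf_sum. Qed.

Lemma shiftp_prod (s : CC) I r (P : pred I) (F : I -> {poly CC}) :
  shiftp s (\prod_(i <- r | P i) F i) = \prod_(i <- r | P i) shiftp s (F i).
Proof.
by elim/big_rec2: _ => [|i p q _ <-]; rewrite ?shiftp1 // shiftpM.
Qed.

Lemma shiftpD (s t : CC) (p : {poly CC}) : shiftp s (shiftp t p) = shiftp (s + t) p.
Proof.
rewrite /shiftp -comp_polyA; congr (_ \Po _).
by rewrite comp_polyD comp_polyX comp_polyC -addrA -polyCD.
Qed.

Lemma shiftp_Tp (lam : CC) (i j : int) :
  shiftp (2 * j%:~R) (Tp lam i) = Tp lam (i + j).
Proof.
rewrite /Tp shiftpZ shiftpB [('X + _) ^+ 2]expr2 shiftpM -expr2.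
rewrite /shiftp comp_polyD comp_polyX !comp_polyC -addrA -polyCD.
congr (_ *: (_ - ('X + _%:P) ^+ 2)).
rewrite !(rmorphB, rmorphM, rmorphD) /=; ring.
Qed.

Lemma shiftp_T1N2 (lam : CC) : shiftp (-2) (Tp lam 1) = Tp lam 0.
Proof. by have := shiftp_Tp lam 1 (-1); rewrite mulrNz mulr1z mulrN1. Qed.

Lemma shiftp_Tpn (lam : CC) (i : int) (n : nat) :
  shiftp (2 * n%:R) (Tp lam i) = Tp lam (i + n).
Proof. exact: (shiftp_Tp lam i n). Qed.

(** * Products of the [Tp] and the operator model of the algebra *)

Lemma YXpowD (lam : CC) (a b : nat) :
  YXpow lam (a + b) = YXpow lam a * shiftp (2 * a%:R) (YXpow lam b).
Proof.
rewrite /YXpow big_split_ord /= shiftp_prod; congr (_ * _).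
apply: eq_bigr => i _; rewrite shiftp_Tpn; congr Tp; lia.
Qed.

Lemma shiftp_XYpow (lam : CC) (b : nat) :
  shiftp (2 * b%:R) (XYpow lam b) = YXpow lam b.
Proof.
(* The translation turns [T_(-j)] into [T_(b-j)], so [T_1, ..., T_b] appear in reverse order. *)
rewrite /XYpow /YXpow shiftp_prod (reindex_inj rev_ord_inj).
apply: eq_bigr => i _; rewrite shiftp_Tpn /=; congr Tp.
have := ltn_ord i; lia.
Qed.

(* Faithful model: [X] acts on polynomials as the shift [H -> H - 2] and [Y] as
   [T_1(H)] times the inverse shift; [weylp x] is the polynomial [P] such that
   the homogeneous element [x] of weight [2m] acts as [P] times the [m]-th power
   of the shift. *)
Definition weylp (lam : CC) (x : welt) : {poly CC} :=
  if 0 <= wt x then shiftp (- (2 * (wt x)%:~R)) (wp x)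
  else wp x * YXpow lam `|wt x|%N.

Lemma wt_wmul (lam : CC) (x y : welt) : wt (wmul lam x y) = wt x + wt y.
Proof. by rewrite /wmul; do ![case: ifP => //=]. Qed.

Lemma weylp_nat (lam : CC) (n : nat) (p : {poly CC}) :
  weylp lam (WElt n p) = shiftp (- (2 * n%:R)) p.
Proof. by []. Qed.

(** Weight 0 falls in the other branch of [weylp], where the empty product gives the same value. *)
Lemma weylp_oppnat (lam : CC) (n : nat) (p : {poly CC}) :
  weylp lam (WElt (- n%:Z) p) = p * YXpow lam n.
Proof.
case: n => [|n]; last by [].
by rewrite oppr0 weylp_nat mulr0 oppr0 shiftp0 /YXpow big_ord0 mulr1.
Qed.

(** With [S] the shift [H -> H - 2], operators compose as [P S^m Q S^n = P S^m(Q) S^(m+n)]; this one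
    formula replaces the sign cases of [wmul] from here on. *)
Lemma weylp_wmul (lam : CC) (x y : welt) :
  weylp lam (wmul lam x y) =
  weylp lam x * shiftp (- (2 * (wt x)%:~R)) (weylp lam y).
Proof.
have int_case (m : int) : (exists n : nat, m = n) \/ (exists n : nat, m = - n.+1%:Z).
  by case: m => m; [left | right]; exists m => //; rewrite NegzE.
case: x y => m p [n q].
have [[{}m ->]|[a ->]] := int_case m; have [[{}n ->]|[b ->]] := int_case n;
  rewrite /wmul /= ?abszN ?absz_nat.
- rewrite -PoszD !weylp_nat shiftpM !shiftpD.
  by rewrite natrD mulrDr opprD addrNK.
(* The shorter of the two powers is absorbed into a polynomial; the surplus of the longer one gives
   the weight. *)
- rewrite weylp_nat weylp_oppnat; case: (leqP m b.+1) => h.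
  + have -> : m%:Z - b.+1%:Z = - (b.+1 - m)%N%:Z by lia.
    rewrite weylp_oppnat -{2}(subnKC h) YXpowD -(shiftp_XYpow lam m) !shiftpM !shiftpD.
    by rewrite -pmulrn addNr !shiftp0 !mulrA.
  + have -> : m%:Z - b.+1%:Z = (m - b.+1)%N%:Z by lia.
    rewrite weylp_nat -(shiftp_XYpow lam b.+1) !shiftpM !shiftpD -pmulrn.
    by rewrite natrB 1?ltnW // mulrBr opprB [_ - 2 * m%:R]addrC addrK mulrA.
- rewrite weylp_nat weylp_oppnat; case: (leqP a.+1 n) => h.
  + have -> : - a.+1%:Z + n%:Z = (n - a.+1)%N%:Z by lia.
    rewrite weylp_nat !shiftpM !shiftpD addNr !shiftp0; congr (_ * shiftp _ _).
    by rewrite natrB // mulrBr opprB mulrNz mulrN opprK.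
  + have -> : - a.+1%:Z + n%:Z = - (a.+1 - n)%N%:Z by lia.
    have -> : YXpow lam a.+1 = YXpow lam (a.+1 - n) *
                shiftp (2 * (a.+1 - n)%:R) (YXpow lam n).
      by rewrite -YXpowD subnK // ltnW.
    rewrite weylp_oppnat shiftpM shiftpD.
    rewrite mulrNz mulrN opprK -mulrBr -pmulrn -natrB 1?ltnW //.
    by rewrite -!mulrA; congr (_ * _); rewrite [LHS]mulrA mulrC.
- rewrite -opprD -PoszD !weylp_oppnat YXpowD !shiftpM opprK mulrNz mulrN opprK -pmulrn.
  by rewrite -!mulrA; congr (_ * _); rewrite mulrCA.
Qed.

(** * The trace on polynomials and its difference identity *)

Lemma trpE (mu : nat -> CC) (n : nat) (p : {poly CC}) : (size p <= n)%N ->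
  trp mu p = \sum_(i < n) p`_i * mu i.
Proof.
move=> hn; rewrite /trp (big_ord_widen n (fun i => p`_i * mu i)) // big_mkcond.
by apply: eq_bigr => i _; case: ltnP => // h; rewrite nth_default ?mul0r.
Qed.

Lemma trpZ (mu : nat -> CC) (c : CC) (p : {poly CC}) : trp mu (c *: p) = c * trp mu p.
Proof.
rewrite (@trpE mu (size p)) ?size_scale_leq // /trp mulr_sumr.
by apply: eq_bigr => i _; rewrite coefZ mulrA.
Qed.

Lemma trpB (mu : nat -> CC) : {morph trp mu : p q / p - q >-> p - q}.
Proof.
move=> p q; set n := maxn (size p) (size q).
have hp : (size p <= n)%N by rewrite leq_maxl.
have hq : (size q <= n)%N by rewrite leq_maxr.
have hpq : (size (p - q)%R <= n)%N.
  by rewrite (leq_trans (size_polyD _ _)) // geq_max size_polyN hp.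
rewrite !(@trpE mu n) // -sumrB; apply: eq_bigr => i _.
by rewrite coefB mulrBl.
Qed.

HB.instance Definition _ (mu : nat -> CC) :=
  GRing.isZmodMorphism.Build {poly CC} CC (trp mu) (trpB mu).

Lemma trpXn (mu : nat -> CC) (n : nat) : trp mu 'X^n = mu n.
Proof.
rewrite (@trpE mu n.+1) ?size_polyXn // big_ord_recr /= coefXn eqxx mul1r.
by rewrite big1 ?add0r // => i _; rewrite coefXn ltn_eqF ?mul0r.
Qed.

Lemma trp_shiftXn (mu : nat -> CC) (s : CC) (n : nat) :
  trp mu (shiftp s 'X^n) = \sum_(i < n.+1) 'C(n, i)%:R * s ^+ (n - i) * mu i.
Proof.
rewrite /shiftp comp_Xn_poly addrC exprDn raddf_sum; apply: eq_bigr => i _.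
by rewrite -polyC_exp mul_polyC raddfMn /= trpZ trpXn -mulrA mulr_natl.
Qed.

(** Taken with [c] binomial, [a = i!], [b = (n-i)!] and [c * (a * b) = n!], this matches a binomial
    summand with a summand of the exponential convolution. *)
Lemma exp_conv_term (F : fieldType) (c a b m s : F) : a != 0 -> b != 0 ->
  c * m - c * s * m = c * (a * b) * ((m / a) * ((1 - s) / b)).
Proof. by move=> a0 b0; field; rewrite a0 b0. Qed.

(** For [p = 'X^n] this is the coefficient identity of [trace_moments] multiplied by [n!]; linearity
    does the rest. *)
Lemma trp_diff_shift (lam : CC) (mu : nat -> CC) (p : {poly CC}) :
  trace_moments lam mu ->
  trp mu (shiftp 1 p) - trp mu (shiftp (-1) p) =
  if lam != 0 then p.[lam] - p.[- lam] else 2 * p`_1.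
Proof.
move=> Hmu.
have Xn n : trp mu (shiftp 1 'X^n) - trp mu (shiftp (-1) 'X^n) =
    if lam != 0 then lam ^+ n - (- lam) ^+ n else if n == 1%N then 2 else 0.
  have nf : n`!%:R != 0 :> CC by rewrite pnatr_eq0 -lt0n fact_gt0.
  transitivity (n`!%:R * (if lam != 0 then (lam ^+ n - (- lam) ^+ n) / (n`!)%:R
      else (if n == 1%N then 2 else 0)) : CC); last first.
    case: ifP => _; first by rewrite mulrC divfK.
    by case: eqP => [->|]; rewrite ?mulr0 // (_ : 1`! = 1%N) // mul1r.
  rewrite -Hmu !trp_shiftXn -sumrB mulr_sumr; apply: eq_bigr => i _.
  have hi : (i <= n)%N by rewrite -ltnS.
  have fi : i`!%:R != 0 :> CC by rewrite pnatr_eq0 -lt0n fact_gt0.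
  have fni : (n - i)`!%:R != 0 :> CC by rewrite pnatr_eq0 -lt0n fact_gt0.
  by rewrite expr1n mulr1 -(bin_fact hi) !natrM -exp_conv_term.
rewrite {1 2}(_ : p = \sum_(i < size p) p`_i *: 'X^i); last by rewrite -poly_def coefK.
rewrite !shiftp_sum !(raddf_sum (trp mu)) -sumrB /=.
under eq_bigr => i _ do rewrite !shiftpZ !trpZ /= -mulrBr Xn.
case: ifP => h.
  by rewrite !horner_coef -sumrB; apply: eq_bigr => i _; rewrite mulrBr.
(* For [lam = 0] only the linear coefficient contributes; it is the default 0 when [p] is
   constant. *)
have [s|s] := leqP (size p) 1.
  rewrite nth_default // mulr0 big1 // => i _.
  by rewrite ltn_eqF ?mulr0 // (leq_trans (ltn_ord i)).
rewrite (bigD1 (Ordinal s)) //= big1 ?addr0 1?mulrC // => i.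
by rewrite -val_eqE /= => /negbTE ->; rewrite mulr0.
Qed.

(** This is [tr(Y u) = tr(u Y)] for [u = X g(H)]. The sides are the traces of [F(H+1)] and [F(H-1)]
    with [F = T_1(H-1) g(H-1)], and [T_1(H-1) = (lam^2 - H^2)/4] vanishes at both [lam] and [-lam],
    doubly at 0 if [lam = 0]. *)
Lemma trp_T1 (lam : CC) (mu : nat -> CC) (g : {poly CC}) :
  trace_moments lam mu ->
  trp mu (Tp lam 1 * g) = trp mu (Tp lam 0 * shiftp (-2) g).
Proof.
move=> Hmu; apply/eqP; rewrite -subr_eq0; apply/eqP.
pose p := shiftp (-1) (Tp lam 1) * shiftp (-1) g.
have p1 : shiftp 1 p = Tp lam 1 * g.
  by rewrite /p shiftpM !shiftpD subrr !shiftp0.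
have pN1 : shiftp (-1) p = Tp lam 0 * shiftp (-2) g.
  have e2 : -1 + -1 = -2 :> CC by rewrite -opprD.
  by rewrite /p shiftpM !shiftpD e2 shiftp_T1N2.
have Tpm1 : shiftp (-1) (Tp lam 1) = 4^-1 *: ((lam ^+ 2)%:P - 'X ^+ 2).
  rewrite /Tp shiftpZ shiftpB [('X + _) ^+ 2]expr2 shiftpM -expr2.
  rewrite /shiftp comp_polyD comp_polyX !comp_polyC -addrA -polyCD.
  by rewrite (addNr (1 : CC)) addr0.
have := trp_diff_shift p Hmu; rewrite p1 pN1 => ->; rewrite /p Tpm1; case: ifP => [_|].
  by rewrite !hornerE sqrrN subrr !(mulr0, mul0r) subrr.
move/eqP => ->; rewrite expr0n sub0r scalerN mulNr coefN -scalerAl coefZ.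
by rewrite coefXnM /= mulr0 oppr0 mulr0.
Qed.

(** * The action of [ad Y] and its skewness for the trace form *)

Lemma wt_adY (lam : CC) (x : welt) : wt (adY lam x) = wt x - 1.
Proof. by rewrite /adY /wsub wt_wmul /= addrC. Qed.

Lemma wt_iter_adY (lam : CC) (n : nat) (x : welt) :
  wt (iter n (adY lam) x) = wt x - n%:Z.
Proof. by elim: n => [|n IH] /=; rewrite ?subr0 // wt_adY IH; lia. Qed.

Lemma e_wt (lam : CC) (k : nat) (l : int) : (`|l| <= k)%N -> wt (e_ lam k l) = l.
Proof. by move=> h; rewrite /e_ wt_iter_adY /=; lia. Qed.

Lemma wform_weight (lam : CC) (mu : nat -> CC) (u v : welt) :
  wt u + wt v != 0 -> wform lam mu u v = 0.
Proof. by rewrite /wform /trw wt_wmul => /negbTE ->. Qed.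

Lemma weylp_wt0 (lam : CC) (x : welt) : wt x = 0 -> weylp lam x = wp x.
Proof. by case: x => m p /= ->; rewrite weylp_nat mulr0 oppr0 shiftp0. Qed.

Lemma wform_weylp (lam : CC) (mu : nat -> CC) (u v : welt) : wt u + wt v = 0 ->
  wform lam mu u v = trp mu (weylp lam u * shiftp (- (2 * (wt u)%:~R)) (weylp lam v)).
Proof.
move=> h; rewrite -weylp_wmul weylp_wt0 ?wt_wmul //.
by rewrite /wform /trw wt_wmul h eqxx.
Qed.

Lemma weylp_wsub (lam : CC) (x y : welt) : wt x = wt y ->
  weylp lam (wsub x y) = weylp lam x - weylp lam y.
Proof.
by move=> h; rewrite /weylp /= -h; case: ifP; rewrite ?shiftpB ?mulrBl.
Qed.

Lemma weylp_wY (lam : CC) : weylp lam wY = Tp lam 1.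
Proof. by rewrite (weylp_oppnat lam 1) /YXpow big_ord1 mul1r. Qed.

Lemma weylp_adY (lam : CC) (x : welt) :
  weylp lam (adY lam x) =
  Tp lam 1 * shiftp 2 (weylp lam x)
  - weylp lam x * shiftp (- (2 * (wt x)%:~R)) (Tp lam 1).
Proof.
rewrite /adY weylp_wsub; last by rewrite !wt_wmul addrC.
rewrite !weylp_wmul weylp_wY /wY [wt (WElt _ _)]/=.
by rewrite mulrNz mulr1z mulrN1 opprK.
Qed.

(** The Leibniz rule [[Y,u] v + u [Y,v] = [Y, u v]] on operator symbols: [t1], [t2], [t3] are
    translates of [T_1], and a prime is translation by 2. *)
Lemma comm_telescope (R : comPzRingType) (t1 t2 t3 p p' q q' : R) :
  (t1 * p' - p * t2) * q' + p * (t2 * q' - q * t3) = t1 * (p' * q') - t3 * (p * q).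
Proof. ring. Qed.

Lemma wform_adY (lam : CC) (mu : nat -> CC) (u v : welt) :
  trace_moments lam mu -> wt u + wt v = 1 ->
  wform lam mu (adY lam u) v = - wform lam mu u (adY lam v).
Proof.
move=> Hmu h.
have h1 : wt (adY lam u) + wt v = 0 by rewrite wt_adY; lia.
have h2 : wt u + wt (adY lam v) = 0 by rewrite wt_adY; lia.
rewrite (wform_weylp _ _ h1) (wform_weylp _ _ h2) !weylp_adY wt_adY.
set P := weylp lam u; set Q := weylp lam v.
set m := (wt u)%:~R : CC.
have -> : (wt u - 1)%:~R = m - 1 by rewrite intrB.
have -> : (wt v)%:~R = 1 - m.
  by rewrite -[wt v](addKr (wt u)) h addrC intrD rmorphN.
have e1 : - (2 * (m - 1)) = 2 - 2 * m by rewrite mulrBr mulr1 opprB.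
have e2 : - (2 * m) + 2 = 2 - 2 * m by rewrite addrC.
have e3 : - (2 * m) - 2 * (1 - m) = -2.
  by rewrite -opprD -mulrDr addrCA addrN addr0 mulr1.
rewrite shiftpB !shiftpM !shiftpD e1 e2 e3 shiftp_T1N2.
(* The argument is the symbol of [u v] translated by 2, so that [trp_T1] becomes [tr [Y, u v] =
   0]. *)
have := trp_T1 (shiftp 2 P * shiftp (2 - 2 * m) Q) Hmu.
rewrite shiftpM !shiftpD addNr addrA addNr add0r shiftp0 => E.
apply/eqP; rewrite -addr_eq0 -raddfD; apply/eqP.
transitivity (trp mu (Tp lam 1 * (shiftp 2 P * shiftp (2 - 2 * m) Q) -
   Tp lam 0 * (P * shiftp (- (2 * m)) Q))); last by rewrite trpB E subrr.
by congr trp; exact: comm_telescope.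
Qed.

Lemma wform_iter_adY (lam : CC) (mu : nat -> CC) (n : nat) (u v : welt) :
  trace_moments lam mu -> wt u + wt v = n%:Z ->
  wform lam mu (iter n (adY lam) u) v = (-1) ^+ n * wform lam mu u (iter n (adY lam) v).
Proof.
move=> Hmu; elim: n u => [|n IH] u h; first by rewrite mul1r.
rewrite iterSr IH ?wt_adY; last by lia.
rewrite wform_adY ?wt_iter_adY //; last by lia.
by rewrite exprSr -mulrA mulN1r.
Qed.

(* The bracket [[Y, X^(l+1) f(H)]] is [X^l (Aop l f)(H)]. *)
Definition Aop (lam : CC) (l : nat) (p : {poly CC}) : {poly CC} :=
  Tp lam l.+1 * p - Tp lam 0 * shiftp (-2) p.

Lemma wp_adY (lam : CC) (l : nat) (x : welt) : wt x = l.+1 ->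
  wp (adY lam x) = Aop lam l (wp x).
Proof.
case: x => m p /= ->; rewrite /adY /wsub /wmul /= /Aop.
rewrite subn1 /= mul1r /YXpow big_ord1 shiftp_Tpn.
rewrite (_ : minn _ _ = 1%N); last by lia.
by rewrite mulr1 /XYpow big_ord1 mulr1 oppr0 [Tp lam 0 * _]mulrC.
Qed.

(** * Orthogonality of [f_kl] to lower degrees *)

Lemma f_kk (lam : CC) (k : nat) : f_ lam k k = 1.
Proof. by rewrite /f_ /e_ subrr. Qed.

Lemma f_rec (lam : CC) (k l : nat) : (l < k)%N ->
  f_ lam k l = Aop lam l (f_ lam k l.+1).
Proof.
move=> h; rewrite /f_ /e_.
rewrite (_ : `|k%:Z - l%:Z|%N = (`|k%:Z - l.+1%:Z|%N).+1); last by lia.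
by rewrite iterS (@wp_adY _ l) // wt_iter_adY /=; lia.
Qed.

(** With [W = T_1 ... T_l], the weight [T_1 ... T_(l+1)] is both [W T_(l+1)] and [T_1 W(H+2)]. The
    first reading handles [T_(l+1) f]; the second lets [trp_T1] move the translation from [f] to
    [g]. *)
Lemma lform_Aop (lam : CC) (mu : nat -> CC) (l : nat) (f g : {poly CC}) :
  trace_moments lam mu ->
  lform lam mu l (Aop lam l f) g = lform lam mu l.+1 f (g - shiftp 2 g).
Proof.
move=> Hmu; rewrite /lform /Aop.
set W := \prod_(i < l) _.
have recW : \prod_(i < l.+1) Tp lam i.+1 = W * Tp lam l.+1 by rewrite big_ord_recr.
have EW : W * Tp lam l.+1 = Tp lam 1 * shiftp 2 W.
  rewrite -recW big_ord_recl /=.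
  congr (_ * _); rewrite /W shiftp_prod; apply: eq_bigr => i _.
  by have := shiftp_Tpn lam i.+1 1; rewrite mulr1 => ->; congr Tp; rewrite /bump; lia.
rewrite recW.
have := trp_T1 (f * shiftp 2 g * shiftp 2 W) Hmu.
rewrite !shiftpM !shiftpD addNr !shiftp0 => E.
transitivity (trp mu (f * g * (W * Tp lam l.+1)) -
  trp mu (Tp lam 0 * (shiftp (-2) f * g * W))).
  rewrite -trpB; congr trp; rewrite !mulrBl; congr (_ - _).
    by rewrite -!mulrA [LHS]mulrC -!mulrA.
  by rewrite !mulrA.
rewrite -E -trpB; congr trp; rewrite [f * (g - _)]mulrBr mulrBl; congr (_ - _).
by rewrite EW mulrCA.
Qed.

(** Translation keeps the degree and the leading coefficient, so the top terms cancel. *)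
Lemma size_diff_shift (s : CC) (p : {poly CC}) :
  (size (p - shiftp s p)%R <= (size p).-1)%N.
Proof.
have [->|p0] := eqVneq p 0; first by rewrite /shiftp comp_poly0 subrr size_poly0.
have sX : size ('X + s%:P) = 2 by rewrite size_XaddC.
have ss : size (shiftp s p) = size p by rewrite /shiftp size_comp_poly2.
apply/leq_sizeP => j hj; rewrite coefB.
have [h|h] := leqP (size p) j; first by rewrite !nth_default ?ss ?subrr.
have -> : j = (size p).-1 by lia.
rewrite -{2}ss -!lead_coefE lead_coef_comp ?sX // lead_coefXaddC expr1n mulr1.
by rewrite subrr.
Qed.

Lemma lform_f_lower (lam : CC) (mu : nat -> CC) (k l : nat) (g : {poly CC}) :
  trace_moments lam mu -> (l <= k)%N -> (size g <= k - l)%N ->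
  lform lam mu l (f_ lam k l) g = 0.
Proof.
move=> Hmu; move: {2}(k - l)%N (erefl (k - l)%N) => n.
elim: n l g => [|n IH] l g hn hl hg.
  (* At [l = k] the degree bound leaves only the zero polynomial. *)
  have -> : g = 0 by apply/eqP; rewrite -size_poly_leq0 -hn.
  by rewrite /lform mulr0 mul0r raddf0.
rewrite f_rec ?lform_Aop //; last by lia.
apply: IH; [lia | lia |].
by have := size_diff_shift 2 g; lia.
Qed.

Lemma lformC (lam : CC) (mu : nat -> CC) (l : nat) (f g : {poly CC}) :
  lform lam mu l f g = lform lam mu l g f.
Proof. by rewrite /lform [f * g]mulrC. Qed.

(** * Bases with one polynomial in each degree *)

Lemma graded_free (F : fieldType) (b : nat -> {poly F}) (n : nat) (c : nat -> F) :
  (forall i, size (b i) = i.+1) -> \sum_(i < n) c i *: b i = 0 ->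
  forall i, (i < n)%N -> c i = 0.
Proof.
move=> sb; elim: n => [//|n IH] E.
have cn : c n = 0.
  (* Only [b n] reaches degree [n], so the coefficient there isolates [c n]. *)
  move: (congr1 (fun p : {poly F} => p`_n) E); rewrite big_ord_recr /= coef0 coefD coef_sum.
  rewrite big1 => [|i _]; last by rewrite coefZ nth_default ?mulr0 // sb.
  rewrite add0r coefZ => /eqP; rewrite mulf_eq0 => /orP[/eqP //|].
  have -> : (b n)`_n = lead_coef (b n) by rewrite lead_coefE sb.
  by rewrite lead_coef_eq0 -size_poly_eq0 sb.
move=> i; rewrite ltnS leq_eqVlt => /orP[/eqP -> //|]; apply: IH.
by move: E; rewrite big_ord_recr /= cn scale0r addr0.
Qed.

Lemma graded_span (F : fieldType) (b : nat -> {poly F}) (n : nat) (p : {poly F}) :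
  (forall i, size (b i) = i.+1) -> (size p <= n)%N ->
  exists c : nat -> F, p = \sum_(i < n) c i *: b i.
Proof.
move=> sb; elim: n p => [|n IH] p sp.
  exists (fun=> 0); rewrite big_ord0; apply/eqP.
  by rewrite -size_poly_leq0.
have bn : (b n)`_n != 0.
  have -> : (b n)`_n = lead_coef (b n) by rewrite lead_coefE sb.
  by rewrite lead_coef_eq0 -size_poly_eq0 sb.
pose a := p`_n / (b n)`_n.
have [|c Ec] := IH (p - a *: b n).
  apply/leq_sizeP => j; rewrite leq_eqVlt => /orP[/eqP <-|hj].
    by rewrite coefB coefZ divfK ?subrr.
  by rewrite coefB coefZ !nth_default ?sb ?mulr0 ?subrr // (leq_trans sp).
exists (fun i => if i == n then a else c i).
rewrite big_ord_recr /= eqxx -[LHS](subrK (a *: b n)) Ec; congr (_ + _).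
by apply: eq_bigr => i _; rewrite ltn_eqF.
Qed.

(** * Pochhammer symbols and the hypergeometric form *)

Lemma pochSl (R : comPzRingType) (a : R) (i : nat) : poch a i.+1 = a * poch (a + 1) i.
Proof.
rewrite /poch big_ord_recl addr0; congr (_ * _); apply: eq_bigr => j _.
by rewrite -addrA nat1r.
Qed.

Lemma pochSr (R : comPzRingType) (a : R) (i : nat) : poch a i.+1 = poch a i * (a + i%:R).
Proof. by rewrite /poch big_ord_recr. Qed.

Lemma poch_neq0 (F : fieldType) (a : F) (n : nat) :
  (forall i, (i < n)%N -> a + i%:R != 0) -> poch a n != 0.
Proof. by move=> h; apply/prodf_neq0 => i _; apply: h. Qed.

Lemma pochnat_neq0 (n i : nat) : poch (n.+1%:R : CC) i != 0.
Proof. by apply: poch_neq0 => j _; rewrite -natrD pnatr_eq0. Qed.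

Lemma pochnat_sub_neq0 (lam : CC) (n i : nat) :
  (forall n : int, n != 0 -> lam != n%:~R) -> poch (n.+1%:R - lam) i != 0.
Proof.
move=> Hlam; apply: poch_neq0 => j _; rewrite addrAC -natrD subr_eq0 eq_sym.
exact: (Hlam (n.+1 + j)%N).
Qed.

(** The series parameter [x = (1 - lam - H)/2], for which [H -> H - 2] becomes [x -> x + 1]. *)
Definition hyparg (lam : CC) : {poly CC} := 2^-1 *: ((1 - lam)%:P - 'X).

Lemma half_square_factor (R : comPzRingType) (h a x n : R) : 2 * h = 1 ->
  h * h * (a ^+ 2 - (x + (2 * n - 1)) ^+ 2) =
  (n - h * (1 - a - x)) * (h * (1 - a - x) + a - n).
Proof.
move=> h1.
(* Writing [n] as [2hn] and [a] as [2ha] makes this a plain polynomial identity, a difference of two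
   squares. *)
transitivity ((2 * h * n - h * (1 - a - x)) * (h * (1 - a - x) + 2 * h * a - 2 * h * n)).
  by ring.
by rewrite h1 !mul1r.
Qed.

Lemma Tp_hyparg (lam : CC) (n : nat) :
  Tp lam n = (n%:R - hyparg lam) * (hyparg lam + lam%:P - n%:R).
Proof.
rewrite /Tp /hyparg -!mul_polyC polyCB polyC_exp polyC1.
have -> : (4^-1)%:P = (2^-1)%:P * (2^-1)%:P :> {poly CC}.
  by rewrite -polyCM -invfM -natrM.
have -> : ((2 * n%:Z - 1)%:~R)%:P = 2 * n%:R - 1 :> {poly CC}.
  by rewrite intrB intrM rmorphB rmorphM /= -!pmulrn !rmorph_nat.
apply: half_square_factor.
by rewrite -(rmorph_nat (@polyC CC)) -polyCM divff ?pnatr_eq0.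
Qed.

Lemma shiftp_hyparg (lam : CC) : shiftp (-2) (hyparg lam) = hyparg lam + 1.
Proof.
rewrite /hyparg shiftpZ shiftpB /shiftp comp_polyC comp_polyX opprD addrA scalerDr.
congr (_ + _); rewrite -polyCN opprK -mul_polyC -polyCM mulVf ?pnatr_eq0 //.
Qed.

Lemma shiftp_poch (s : CC) (p : {poly CC}) (i : nat) :
  shiftp s (poch p i) = poch (shiftp s p) i.
Proof.
rewrite /poch shiftp_prod; apply: eq_bigr => j _.
by rewrite /shiftp comp_polyD -(rmorph_nat (@polyC CC)) comp_polyC.
Qed.

(** Here [p = (x)_i] and [r = (x+1)_i], linked by the two factorisations of [(x)_(i+1)]; the [T_0]
    term supplies the factor [x] in front of [r]. *)
Lemma hyp_contiguous (R : comPzRingType) (x a n i p r : R) : x * r = p * (x + i) ->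
  (n - x) * (x + a - n) * p - (0 - x) * (x + a - 0) * r =
  (2 * n + i) * (p * (x + i)) - (n + i) * (n + i - a) * p.
Proof.
move=> E.
transitivity ((n - x) * (x + a - n) * p + (x + a) * (x * r)); first by ring.
by rewrite E; ring.
Qed.

Lemma Aop_poch (lam : CC) (l i : nat) :
  Aop lam l (poch (hyparg lam) i) =
  (2 * l.+1%:R + i%:R) *: poch (hyparg lam) i.+1
  - ((l.+1%:R + i%:R) * (l.+1%:R + i%:R - lam)) *: poch (hyparg lam) i.
Proof.
rewrite /Aop shiftp_poch shiftp_hyparg !Tp_hyparg pochSr -!mul_polyC.
rewrite !(polyCD, polyCM, polyCN) !(rmorph_nat (@polyC CC)).
by apply: hyp_contiguous; rewrite -pochSl pochSr.
Qed.

Definition F32coef (lam : CC) (k l i : nat) : CC :=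
  poch ((l%:Z - k%:Z)%:~R : CC) i * poch ((l + k + 1)%:R : CC) i
      / (poch ((l + 1)%:R : CC) i * poch ((l + 1)%:R - lam) i * (i`!)%:R).

Lemma F32E (lam : CC) (k l : nat) :
  F32 lam k l = \sum_(i < (k - l).+1) F32coef lam k l i *: poch (hyparg lam) i.
Proof. by []. Qed.

(** Used with [al = l-k], [be = l+k+1], [ga = l+1], [de = l+1-lam]. Cleared of denominators it reads
    [- al be = (2 ga + j)(j+1) - (al+1+j)(be+1+j)], which is the relation [al + be + 1 = 2 ga]. *)
Lemma F32coef_contiguous (F : fieldType) (al be ga de A B C D f j : F) :
  al + be + 1 = 2 * ga -> ga != 0 -> de != 0 -> C != 0 -> D != 0 -> f != 0 ->
  j + 1 != 0 -> ga + 1 + j != 0 -> de + 1 + j != 0 ->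
  - (ga * de) * (al * A * (be * B) / (ga * C * (de * D) * ((j + 1) * f))) =
  (2 * ga + j) * (A * B / (C * D * f)) -
  (ga + (j + 1)) * (de + (j + 1)) *
  (A * (al + 1 + j) * (B * (be + 1 + j)) /
     (C * (ga + 1 + j) * (D * (de + 1 + j)) * ((j + 1) * f))).
Proof.
move=> /(canRL (addrK _)) /(canRL (addKr _)) -> *.
by field; do ?[apply/andP; split].
Qed.

Lemma F32coef_rec (lam : CC) (k l j : nat) :
  (forall n : int, n != 0 -> lam != n%:~R) ->
  - (l.+1%:R * (l.+1%:R - lam)) * F32coef lam k l j.+1 =
  (2 * l.+1%:R + j%:R) * F32coef lam k l.+1 j -
  (l.+1%:R + j.+1%:R) * (l.+1%:R + j.+1%:R - lam) * F32coef lam k l.+1 j.+1.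
Proof.
move=> Hlam; rewrite /F32coef.
have nz (n : nat) : n.+1%:R - lam != 0.
  by rewrite subr_eq0 eq_sym; apply: (Hlam n.+1).
have e1 : (l.+1%:Z - k%:Z)%:~R = (l%:Z - k%:Z)%:~R + 1 :> CC.
  by rewrite -[1]/(1%:~R) -intrD; congr (_%:~R); lia.
have e2 : (l.+1 + k + 1)%:R = (l + k + 1)%:R + 1 :> CC by rewrite natr1; congr (_%:R); lia.
have e3 : (l + 1)%:R = l.+1%:R :> CC by rewrite addn1.
have e4 : (l.+1 + 1)%:R = l.+1%:R + 1 :> CC by rewrite natr1 addn1.
have e5 : l.+1%:R + 1 - lam = (l.+1%:R - lam) + 1 by rewrite addrAC.
rewrite e1 e2 e4 e5 e3.
have C0 : poch (l.+1%:R + 1 : CC) j != 0 by rewrite natr1 pochnat_neq0.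
have D0 : poch (l.+1%:R - lam + 1) j != 0.
  by rewrite addrAC natr1 pochnat_sub_neq0.
have f0 : j`!%:R != 0 :> CC by rewrite pnatr_eq0 -lt0n fact_gt0.
rewrite factS natrM -(natr1 j).
(* Level [l] is split at the front and level [l+1] at the back, so that both share the symbols
   [(a+1)_j]. *)
rewrite (pochSl _ j) [poch (l + k + 1)%:R _](pochSl _ j) [poch l.+1%:R _](pochSl _ j).
rewrite [poch (l.+1%:R - lam) _](pochSl _ j).
rewrite !(pochSr _ j) [l.+1%:R + (j%:R + 1) - lam]addrAC.
apply: F32coef_contiguous => //.
- rewrite pmulrn -[1]/(1%:~R) -!intrD -natrM pmulrn; congr (_%:~R); lia.
- by rewrite pnatr_eq0.
- by rewrite natr1 pnatr_eq0.
- by rewrite -addrA nat1r -natrD pnatr_eq0.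
- by rewrite -addrA nat1r addrAC -natrD addSn nz.
Qed.

Lemma linear_comb2D (R : comPzRingType) (a b p q p' q' : R) :
  a * (p + q) - b * (p' + q') = (a * p - b * p') + (a * q - b * q').
Proof. ring. Qed.

Lemma AopD (lam : CC) (l : nat) (p q : {poly CC}) :
  Aop lam l (p + q) = Aop lam l p + Aop lam l q.
Proof. by rewrite /Aop [in LHS]/shiftp comp_polyD; exact: linear_comb2D. Qed.

Lemma AopZ (lam : CC) (l : nat) (c : CC) (p : {poly CC}) :
  Aop lam l (c *: p) = c *: Aop lam l p.
Proof. by rewrite /Aop shiftpZ scalerBr; congr (_ - _); rewrite scalerAr. Qed.

Lemma Aop_sum (lam : CC) (l n : nat) (c : nat -> CC) (p : nat -> {poly CC}) :
  Aop lam l (\sum_(i < n) c i *: p i) = \sum_(i < n) c i *: Aop lam l (p i).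
Proof.
elim: n => [|n IH]; first by rewrite !big_ord0 -(scale0r 0) AopZ !scale0r.
by rewrite !big_ord_recr /= AopD AopZ IH.
Qed.

Lemma Aop_F32 (lam : CC) (k l : nat) :
  (forall n : int, n != 0 -> lam != n%:~R) -> (l < k)%N ->
  Aop lam l (F32 lam k l.+1) = - (l.+1%:R * (l.+1%:R - lam)) *: F32 lam k l.
Proof.
move=> Hlam h; set c := - _.
have -> : F32 lam k l.+1 = \sum_(i < k - l) F32coef lam k l.+1 i *: poch (hyparg lam) i.
  by rewrite F32E subnSK.
rewrite (Aop_sum _ _ _ (F32coef lam k l.+1) (poch (hyparg lam))) F32E scaler_sumr.
(* The series for [l+1] stops one term earlier: [(l+1-k)_(k-l)] ends with a zero factor. *)
have top0 : F32coef lam k l.+1 (k - l) = 0.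
  rewrite /F32coef (_ : poch (l.+1%:Z - k%:Z)%:~R (k - l) = 0) ?mul0r //.
  have -> : (k - l = (k - l.+1).+1)%N by lia.
  rewrite pochSr pmulrn -intrD (_ : l.+1%:Z - k%:Z + (k - l.+1)%N%:Z = 0) ?mulr0z ?mulr0 //.
  lia.
pose Q i := (l.+1%:R + i%:R) * (l.+1%:R + i%:R - lam) * F32coef lam k l.+1 i.
(* Regroup by [(x)_i]: it is reached from index [i-1], absent for [i = 0], and from index [i]. *)
transitivity (\sum_(i < (k - l).+1)
   ((if (i : nat) is j.+1 then (2 * l.+1%:R + j%:R) * F32coef lam k l.+1 j else 0) - Q i)
     *: poch (hyparg lam) i).
  under [RHS]eq_bigr => i _ do rewrite scalerBl.
  rewrite sumrB big_ord_recl scale0r add0r [X in _ = _ - X]big_ord_recr /=.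
  rewrite {2}/Q top0 mulr0 scale0r addr0 -sumrB; apply: eq_bigr => i _.
  by rewrite Aop_poch scalerBr !scalerA /Q [_ * F32coef _ _ _ _]mulrC
     [_ * _ * F32coef _ _ _ _]mulrC.
apply: eq_bigr => -[[|j] hj] _ /=; rewrite scalerA; congr (_ *: _).
  (* Both series start with 1, so index 0 fixes the scalar. *)
  have F0 l' : F32coef lam k l' 0 = 1.
    by rewrite /F32coef /poch !big_ord0 fact0 !mulr1 divr1.
  by rewrite /Q /c !F0 sub0r !addr0 !mulr1.
by rewrite /Q /c F32coef_rec.
Qed.

(** Both families start from 1 at [l = k]; each step down multiplies the constant by
    [-(l+1)(l+1-lam)], nonzero by the hypothesis on [lam]. *)
Lemma f_F32 (lam : CC) (k l : nat) :
  (forall n : int, n != 0 -> lam != n%:~R) -> (l <= k)%N ->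
  exists c : CC, c != 0 /\ f_ lam k l = c *: F32 lam k l.
Proof.
move=> Hlam; move: {2}(k - l)%N (erefl (k - l)%N) => n.
elim: n l => [|n IH] l hn hl.
  have <- : k = l by lia.
  exists 1; rewrite oner_neq0 f_kk scale1r; split => //.
  by rewrite /F32 subnn big_ord1 /poch !big_ord0 fact0 !mulr1 divr1 scale1r.
have [||c [c0 Ec]] := IH l.+1; try lia.
exists (c * - (l.+1%:R * (l.+1%:R - lam))); split.
  rewrite mulf_neq0 // oppr_eq0 mulf_neq0 ?pnatr_eq0 //.
  by rewrite subr_eq0 eq_sym; apply: (Hlam l.+1).
rewrite f_rec; last by lia.
by rewrite Ec -scalerA -Aop_F32 ?AopZ //; lia.
Qed.

(** * Exact degrees and the three assertions *)

Lemma size_poch_hyparg (lam : CC) (i : nat) : size (poch (hyparg lam) i) = i.+1.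
Proof.
have s2 j : size (hyparg lam + j%:R) = 2.
  have -> : hyparg lam + j%:R = (- 2^-1) *: 'X + (2^-1 * (1 - lam) + j%:R)%:P.
    rewrite /hyparg scalerBr scaleNr -[_ *: _%:P]mul_polyC -polyCM.
    by rewrite -(rmorph_nat (@polyC CC)) addrAC -polyCD addrC.
  rewrite -mul_polyC size_MXaddC polyC_eq0 oppr_eq0 invr_eq0 pnatr_eq0 /=.
  by rewrite size_polyC oppr_eq0 invr_eq0 pnatr_eq0.
elim: i => [|i IH]; first by rewrite /poch big_ord0 size_poly1.
by rewrite pochSr size_mul ?IH ?s2 ?addn2 // -size_poly_eq0 ?IH ?s2.
Qed.

Lemma size_f (lam : CC) (k l : nat) :
  (forall n : int, n != 0 -> lam != n%:~R) -> (l <= k)%N ->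
  size (f_ lam k l) = (k - l).+1.
Proof.
move=> Hlam h; have [c [c0 ->]] := f_F32 Hlam h; rewrite size_scale //.
(* The factors of [(l-k)_(k-l)] run from [l-k] to [-1], so the top coefficient survives. *)
have nz : F32coef lam k l (k - l) != 0.
  rewrite /F32coef !mulf_neq0 ?invr_eq0 ?mulf_neq0 ?addn1 ?pochnat_neq0 //.
  - apply: poch_neq0 => i hi; rewrite pmulrn -intrD intr_eq0; lia.
  - exact: pochnat_sub_neq0.
  - by rewrite pnatr_eq0 -lt0n fact_gt0.
rewrite F32E big_ord_recr /= addrC size_polyDl size_scale ?size_poch_hyparg //.
rewrite ltnS; apply: (leq_trans (size_sum _ _ _)); apply/bigmax_leqP => i _.
by rewrite (leq_trans (size_scale_leq _ _)) // size_poch_hyparg.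
Qed.

Lemma lform_f_orthogonal (lam : CC) (mu : nat -> CC) (k k' l : nat) :
  (forall n : int, n != 0 -> lam != n%:~R) -> trace_moments lam mu ->
  (l <= k)%N -> (l <= k')%N -> k <> k' ->
  lform lam mu l (f_ lam k l) (f_ lam k' l) = 0.
Proof.
move=> Hlam Hmu hk hk' ne; have [lt|lt|//] := ltngtP k k'; last first.
  by apply: lform_f_lower => //; rewrite size_f //; lia.
by rewrite lformC; apply: lform_f_lower => //; rewrite size_f //; lia.
Qed.

Lemma wform_e0 (lam : CC) (mu : nat -> CC) (k k' : nat) :
  wform lam mu (e_ lam k 0) (e_ lam k' 0) = lform lam mu 0 (f_ lam k 0) (f_ lam k' 0).
Proof.
rewrite wform_weylp ?e_wt // !weylp_wt0 ?e_wt // mulr0 oppr0 shiftp0.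
by rewrite /lform big_ord0 mulr1.
Qed.

Theorem theorem9p1 (lam : CC) (mu : nat -> CC)
  (Hlam : forall n : int, n != 0 -> lam != n%:~R)
  (Hmu : trace_moments lam mu) :
  (* (i) *)
  (forall (k k' : nat) (l l' : int),
      (`|l| <= k)%N -> (`|l'| <= k')%N -> ~ (k = k' /\ l + l' = 0) ->
      wform lam mu (e_ lam k l) (e_ lam k' l') = 0)
  /\
  (* (ii) *)
  (forall l : nat,
      (forall k k' : nat, (l <= k)%N -> (l <= k')%N -> k <> k' ->
         lform lam mu l (f_ lam k l) (f_ lam k' l) = 0)
      /\ (forall (n : nat) (c : nat -> CC),
            \sum_(i < n) c i *: f_ lam (l + i) l = 0 -> forall i, (i < n)%N -> c i = 0)
      /\ (forall p : {poly CC}, exists (n : nat) (c : nat -> CC),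
            p = \sum_(i < n) c i *: f_ lam (l + i) l))
  /\
  (* (iii) *)
  (forall k l : nat, (l <= k)%N ->
      exists c : CC, c != 0 /\ f_ lam k l = c *: F32 lam k l).
Proof.
split; [|split]; last by move=> k l; apply: f_F32.
- move=> k k' l l' hl hl' ne.
  have [s0|s0] := eqVneq (l + l') 0; last by rewrite wform_weight ?e_wt.
  have kk' : k <> k' by move=> E; apply: ne.
  have e0 := lform_f_orthogonal Hlam Hmu (leq0n k) (leq0n k') kk'.
  rewrite -wform_e0 in e0.
  (* For [l >= 0], [l] applications of [ad Y] lower [e_(k,l)] to [e_(k,0)] and [e_(k',0)] to
     [e_(k',-l)]; skewness equates the pairings up to sign. *)
  have [l0|l0] := lerP 0 l.
    have El : e_ lam k 0 = iter `|l|%N (adY lam) (e_ lam k l).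
      by rewrite /e_ -iterD; congr iter; lia.
    have El' : e_ lam k' l' = iter `|l|%N (adY lam) (e_ lam k' 0).
      by rewrite /e_ -iterD; congr iter; lia.
    move: e0; rewrite El wform_iter_adY ?e_wt //; last by lia.
    by move/eqP; rewrite mulf_eq0 signr_eq0 El' => /eqP.
  (* For [l < 0] the lowering goes from [e_(k,0)] to [e_(k,l)] and from [e_(k',-l)] to
     [e_(k',0)]. *)
  have El : e_ lam k l = iter `|l|%N (adY lam) (e_ lam k 0).
    by rewrite /e_ -iterD; congr iter; lia.
  have El' : e_ lam k' 0 = iter `|l|%N (adY lam) (e_ lam k' l').
    by rewrite /e_ -iterD; congr iter; lia.
  rewrite El wform_iter_adY ?e_wt //; last by lia.
  by rewrite -El' e0 mulr0.
- move=> l.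
  (* Indexing by [k = l + i] gives one polynomial in each degree [i]. *)
  have sf i : size (f_ lam (l + i) l) = i.+1.
    by rewrite size_f ?leq_addr // addKn.
  split; first by move=> k k' hk hk' ne; apply: lform_f_orthogonal.
  split; first by move=> n c; apply: (graded_free sf).
  by move=> p; exists (size p); apply: (graded_span sf).
Qed.
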